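(* For every modal formula $A$ over $P$, $\vdash_{\mathsf{K}}A$ if and only if $\vdash_{\mathsf{BFNL^*}}\ \Rightarrow A^\dagger$.
   Context: Modal formulas over a set $P$ of propositional letters: $A::=p\mid\bot\mid A\wedge B\mid A\vee B\mid A\supset B\mid\Diamond A$, with $\neg A:=A\supset\bot$, $\Box A:=\neg\Diamond\neg A$. $\mathsf{K}$ is the minimal normal modal logic (axiomatized by propositional tautologies, $\Box(A\supset B)\supset(\Box A\supset\Box B)$, modus ponens and necessitation); $\vdash_{\mathsf{K}}A$ means $A$ is a theorem. Let $m\notin P$ be a distinguished propositional letter. The translation $(\cdot)^\dagger$ into $\mathsf{BFNL^*}$-formulas over $P\cup\{m\}$: $p^\dagger=p$, $\bot^\dagger=\bot$, $(A\wedge B)^\dagger=A^\dagger\wedge B^\dagger$, $(A\vee B)^\dagger=A^\dagger\vee B^\dagger$, $(A\supset B)^\dagger=\neg A^\dagger\vee B^\dagger$, $(\Diamond A)^\dagger=m\cdot A^\dagger$. $\mathsf{BFNL^*}$: formulas $A::=p\mid\top\mid\bot\mid\neg A\mid A\wedge B\mid A\vee B\mid A\cdot B\mid A\backslash B\mid A/B$; formula trees $\Gamma::=A\mid\Gamma\circ\Delta$, with $\Gamma[\Delta]$ a tree with distinguished subtree occurrence $\Delta$; sequents $\Gamma\Rightarrow A$ with $\Gamma$ a formula tree or empty. Axioms: $A\Rightarrow A$; $A\wedge(B\vee C)\Rightarrow(A\wedge B)\vee(A\wedge C)$; $\Gamma[\bot]\Rightarrow A$; $\Gamma\Rightarrow\top$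 ($\Gamma$ possibly empty); $A\wedge\neg A\Rightarrow\bot$; $\top\Rightarrow A\vee\neg A$. Rules: from $\Delta\Rightarrow A$, $\Gamma[B]\Rightarrow C$ infer $\Gamma[\Delta\circ(A\backslash B)]\Rightarrow C$; from $A\circ\Gamma\Rightarrow B$ infer $\Gamma\Rightarrow A\backslash B$; from $\Gamma[A]\Rightarrow C$, $\Delta\Rightarrow B$ infer $\Gamma[(A/B)\circ\Delta]\Rightarrow C$; from $\Gamma\circ B\Rightarrow A$ infer $\Gamma\Rightarrow A/B$ ($\Gamma$ may be empty in these two); from $\Gamma[A\circ B]\Rightarrow C$ infer $\Gamma[A\cdot B]\Rightarrow C$; from $\Gamma\Rightarrow A$, $\Delta\Rightarrow B$ infer $\Gamma\circ\Delta\Rightarrow A\cdot B$; Cut: from $\Delta\Rightarrow A$, $\Gamma[A]\Rightarrow B$ infer $\Gamma[\Delta]\Rightarrow B$; from $\Gamma[A_i]\Rightarrow B$ infer $\Gamma[A_1\wedge A_2]\Rightarrow B$; from $\Gamma\Rightarrow A$, $\Gamma\Rightarrow B$ infer $\Gamma\Rightarrow A\wedge B$; from $\Gamma[A_1]\Rightarrow B$, $\Gamma[A_2]\Rightarrow B$ infer $\Gamma[A_1\vee A_2]\Rightarrow B$; from $\Gamma\Rightarrow A_i$ infer $\Gamma\Rightarrow A_1\vee A_2$.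
   Formalization: The listed axioms for K (with ◇ primitive and □ := ¬◇¬) do not yield ◇¬¬p ⊃ ◇p, although its translation is derivable in BFNL*; the formal K therefore adds the duality axioms ◇A ⊃ ¬□¬A and ¬□¬A ⊃ ◇A, giving the minimal normal modal logic. *)

(* Defs.v *)
From Stdlib Require Import Bool.

Set Implicit Arguments.

Declare Scope modal_scope.
Declare Scope bfnl_scope.

Inductive mform (P : Type) : Type :=
| MVar : P -> mform P
| MBot : mform P
| MAnd : mform P -> mform P -> mform P
| MOr : mform P -> mform P -> mform P
| MImp : mform P -> mform P -> mform P
| MDia : mform P -> mform P.

Arguments MBot {P}.

Definition MNeg (P : Type) (A : mform P) : mform P := MImp A MBot.
Definition MBox (P : Type) (A : mform P) : mform P := MNeg (MDia (MNeg A)).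

Delimit Scope modal_scope with modal.
Bind Scope modal_scope with mform.
Infix "∧" := MAnd (at level 40, left associativity) : modal_scope.
Infix "∨" := MOr (at level 50, left associativity) : modal_scope.
Infix "⊃" := MImp (at level 55, right associativity) : modal_scope.
Notation "¬ A" := (MNeg A) (at level 35, right associativity) : modal_scope.
Notation "◇ A" := (MDia A) (at level 35, right associativity) : modal_scope.
Notation "□ A" := (MBox A) (at level 35, right associativity) : modal_scope.

(* Truth-functional value; letters and formulas [◇ B] both count as atoms, with
   values given by [v] and [d], so that the axioms of K include all modal
   instances of propositional tautologies. *)
Fixpoint peval (P : Type) (v : P -> bool) (d : mform P -> bool) (A : mform P)
  : bool :=
  match A with
  | MVar p => v p
  | MBot => false
  | MAnd B C => peval v d B && peval v d C
  | MOr B C => peval v d B || peval v d C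
  | MImp B C => implb (peval v d B) (peval v d C)
  | MDia B => d B
  end.

Definition tautology (P : Type) (A : mform P) : Prop :=
  forall (v : P -> bool) (d : mform P -> bool), peval v d A = true.

(* Since [◇] is primitive and [□ A] abbreviates [¬ ◇ ¬ A], the minimal normal
   modal logic also needs the duality axiom [◇ A <-> ¬ □ ¬ A]: distribution and
   necessitation only ever mention [◇] in front of a negation, so without
   duality [◇ ¬ ¬ p ⊃ ◇ p] is not derivable. *)
Inductive K_theorem (P : Type) : mform P -> Prop :=
| K_taut : forall A : mform P, tautology A -> K_theorem A
| K_dist : forall A B : mform P, K_theorem (□ (A ⊃ B) ⊃ (□ A ⊃ □ B))%modal
| K_dual1 : forall A : mform P, K_theorem (◇ A ⊃ ¬ □ ¬ A)%modal
| K_dual2 : forall A : mform P, K_theorem (¬ □ ¬ A ⊃ ◇ A)%modal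
| K_mp : forall A B : mform P,
    K_theorem (A ⊃ B)%modal -> K_theorem A -> K_theorem B
| K_nec : forall A : mform P, K_theorem A -> K_theorem (□ A)%modal.

Inductive bform (L : Type) : Type :=
| BVar : L -> bform L
| BTop : bform L
| BBot : bform L
| BNeg : bform L -> bform L
| BAnd : bform L -> bform L -> bform L
| BOr : bform L -> bform L -> bform L
| BProd : bform L -> bform L -> bform L
| BUnder : bform L -> bform L -> bform L
| BOver : bform L -> bform L -> bform L.

Arguments BTop {L}.
Arguments BBot {L}.

Delimit Scope bfnl_scope with bfnl.
Bind Scope bfnl_scope with bform.
Notation "⊤" := BTop : bfnl_scope.
Notation "⊥" := BBot : bfnl_scope.
Infix "∧" := BAnd (at level 40, left associativity) : bfnl_scope.
Infix "∨" := BOr (at level 50, left associativity) : bfnl_scope.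
Notation "¬ A" := (BNeg A) (at level 35, right associativity) : bfnl_scope.
Infix "·" := BProd (at level 38, left associativity) : bfnl_scope.
Infix "\" := BUnder (at level 38, left associativity) : bfnl_scope.
Infix "/" := BOver (at level 40, left associativity) : bfnl_scope.

Inductive tree (L : Type) : Type :=
| Leaf : bform L -> tree L
| Node : tree L -> tree L -> tree L.

(* A formula tree, or empty ([None]). *)
Definition antecedent (L : Type) : Type := option (tree L).

Definition empty {L : Type} : antecedent L := None.

Definition single (L : Type) (A : bform L) : antecedent L := Some (Leaf A).
Coercion single : bform >-> antecedent.

(* The empty antecedent is a two-sided unit for composition. *)
Definition comp (L : Type) (X Y : antecedent L) : antecedent L :=
  match X, Y with
  | None, _ => Y
  | _, None => X
  | Some T, Some U => Some (Node T U)
  end.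

Bind Scope bfnl_scope with antecedent.
Infix "∘" := comp (at level 60, right associativity) : bfnl_scope.

Inductive ctx (L : Type) : Type :=
| Hole : ctx L
| CtxL : ctx L -> tree L -> ctx L
| CtxR : tree L -> ctx L -> ctx L.

(* [plug G X] is Γ[X]; for empty [X] the hole is deleted. *)
Fixpoint plug (L : Type) (G : ctx L) (X : antecedent L) : antecedent L :=
  match G with
  | Hole _ => X
  | CtxL G' T => comp (plug G' X) (Some T)
  | CtxR T G' => comp (Some T) (plug G' X)
  end.

Local Open Scope bfnl_scope.

(* [bfnl X A] is derivability of the sequent X ⇒ A. All antecedents [X], [Y] may
   be empty. Cut needs this to derive [⇒ A ∨ ¬ A] from [⇒ ⊤] and [⊤ ⇒ A ∨ ¬ A];
   the empty instances of [under_l], [over_l], [prod_r], [or_r1] and [or_r2] are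
   then derivable by Cut from the nonempty ones. *)
Inductive bfnl (L : Type) : antecedent L -> bform L -> Prop :=
| ax_id : forall A : bform L, bfnl A A
| ax_distr : forall A B C : bform L,
    bfnl (A ∧ (B ∨ C)) ((A ∧ B) ∨ (A ∧ C))
| ax_bot : forall (G : ctx L) (A : bform L), bfnl (plug G ⊥) A
| ax_top : forall X : antecedent L, bfnl X ⊤
| ax_contr : forall A : bform L, bfnl (A ∧ ¬ A) ⊥
| ax_em : forall A : bform L, bfnl ⊤ (A ∨ ¬ A)
| under_l : forall (G : ctx L) (X : antecedent L) (A B C : bform L),
    bfnl X A -> bfnl (plug G B) C -> bfnl (plug G (X ∘ (A \ B))) C
| under_r : forall (X : antecedent L) (A B : bform L),
    bfnl (A ∘ X) B -> bfnl X (A \ B)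
| over_l : forall (G : ctx L) (X : antecedent L) (A B C : bform L),
    bfnl (plug G A) C -> bfnl X B -> bfnl (plug G ((A / B) ∘ X)) C
| over_r : forall (X : antecedent L) (A B : bform L),
    bfnl (X ∘ B) A -> bfnl X (A / B)
| prod_l : forall (G : ctx L) (A B C : bform L),
    bfnl (plug G (A ∘ B)) C -> bfnl (plug G (A · B)) C
| prod_r : forall (X Y : antecedent L) (A B : bform L),
    bfnl X A -> bfnl Y B -> bfnl (X ∘ Y) (A · B)
| cut : forall (G : ctx L) (X : antecedent L) (A B : bform L),
    bfnl X A -> bfnl (plug G A) B -> bfnl (plug G X) B
| and_l1 : forall (G : ctx L) (A1 A2 B : bform L),
    bfnl (plug G A1) B -> bfnl (plug G (A1 ∧ A2)) B
| and_l2 : forall (G : ctx L) (A1 A2 B : bform L),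
    bfnl (plug G A2) B -> bfnl (plug G (A1 ∧ A2)) B
| and_r : forall (X : antecedent L) (A B : bform L),
    bfnl X A -> bfnl X B -> bfnl X (A ∧ B)
| or_l : forall (G : ctx L) (A1 A2 B : bform L),
    bfnl (plug G A1) B -> bfnl (plug G A2) B -> bfnl (plug G (A1 ∨ A2)) B
| or_r1 : forall (X : antecedent L) (A1 A2 : bform L),
    bfnl X A1 -> bfnl X (A1 ∨ A2)
| or_r2 : forall (X : antecedent L) (A1 A2 : bform L),
    bfnl X A2 -> bfnl X (A1 ∨ A2).

(* P ∪ {m} with m ∉ P is [option P]; the letter m is [None]. *)
Fixpoint dagger (P : Type) (A : mform P) : bform (option P) :=
  match A with
  | MVar p => BVar (Some p)
  | MBot => ⊥
  | MAnd B C => dagger B ∧ dagger C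
  | MOr B C => dagger B ∨ dagger C
  | MImp B C => ¬ dagger B ∨ dagger C
  | MDia B => BVar None · dagger B
  end.

(* Main.v *)
Require Import Defs.
From Stdlib Require Import Bool List Classical ClassicalEpsilon.

(** From K to BFNL*: by induction on K-derivations, [⊤ ⇒ A†] holds. The stronger
    antecedent [⊤] is needed for necessitation, because [⇒ B] does not give
    [⊤ ⇒ B] for arbitrary [B] (consider [B = C \ C]).

    From BFNL* to K: BFNL* is sound for ternary frames in which the empty
    antecedent denotes a single point that is a two-sided unit. If K does not
    prove [A], take a Kripke model refuting [A] at [w] and adjoin two points: a
    point [Mu], the only one satisfying [m], and a copy [Root] of [w] without
    predecessors, which can therefore be made the unit. Then [m · B] and [◇ B]
    agree away from [Mu], so [A†] fails at the unit.

    The Kripke model has formulas as worlds: a world is a consistent [C] that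
    decides every subformula of [A], and it satisfies the [B] with [⊢ C ⊃ B].
    This avoids maximal consistent sets, hence an appeal to Zorn's lemma, for an
    arbitrary set of letters. *)

Set Implicit Arguments.

Local Open Scope bfnl_scope.

(** * Lindenbaum extension over finitely many formulas, and a truth-table tactic *)

Fixpoint subformulas (P : Type) (A : mform P) : list (mform P) :=
  A :: match A with
       | MVar _ | MBot => nil
       | MAnd B C | MOr B C | MImp B C => subformulas B ++ subformulas C
       | MDia B => subformulas B
       end.

Lemma subformulas_self (P : Type) (A : mform P) : In A (subformulas A).
Proof. destruct A; simpl; auto. Qed.

(** Each member of [s] in turn is conjoined to [D], itself or negated, whichever keeps [cons]. Order
    and consistency are abstract so that the argument serves both [bfnl] and [K_theorem]. *)
Lemma deciding_extension (F : Type) (le : F -> F -> Prop) (conj : F -> F -> F)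
    (neg : F -> F) (cons : F -> Prop) :
  (forall D, le D D) ->
  (forall A B C, le A B -> le B C -> le A C) ->
  (forall A B, le (conj A B) A) ->
  (forall A B, le (conj A B) B) ->
  (forall D B, cons D -> cons (conj D B) \/ cons (conj D (neg B))) ->
  forall (s : list F) (D : F), cons D ->
  exists D', cons D' /\ le D' D /\ forall B, In B s -> le D' B \/ le D' (neg B).
Proof.
  intros Hrefl Htrans Hl Hr Hsplit s; induction s as [|B s IH]; intros D HD.
  - exists D; split; [|split]; auto. intros B [].
  - destruct (Hsplit D B HD) as [H|H]; destruct (IH _ H) as (D' & Hc & Hle & Hd);
      exists D'; (split; [exact Hc|split; [now eauto|]]);
      intros B' [<-|HB']; auto; [left|right]; eauto.
Qed.

Ltac taut :=
  let v := fresh "v" in let d := fresh "d" in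
  intros v d; simpl;
  repeat match goal with
  | |- context [peval v d ?A] => destruct (peval v d A)
  | |- context [d ?A] => destruct (d A)
  end; reflexivity.

(** * Boolean reasoning in BFNL* *)

Section Boolean.
Variable L : Type.
Implicit Types (A B C D : bform L).

Lemma le_trans A B C : bfnl A B -> bfnl B C -> bfnl A C.
Proof. intros HAB HBC; exact (cut (Hole L) HAB HBC). Qed.

Lemma and_le_l A B : bfnl (A ∧ B) A.
Proof. exact (and_l1 (Hole L) _ _ (ax_id A)). Qed.

Lemma and_le_r A B : bfnl (A ∧ B) B.
Proof. exact (and_l2 (Hole L) _ _ (ax_id B)). Qed.

Lemma bot_le A : bfnl ⊥ A.
Proof. exact (ax_bot (Hole L) A). Qed.

Lemma or_le A B C : bfnl A C -> bfnl B C -> bfnl (A ∨ B) C.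
Proof. exact (@or_l L (Hole L) A B C). Qed.

Lemma contradiction_le A B C : bfnl A B -> bfnl A (¬ B) -> bfnl A C.
Proof.
  intros H H'; apply le_trans with (1 := and_r H H').
  exact (le_trans (ax_contr B) (bot_le C)).
Qed.

Lemma le_cases A B C D :
  bfnl D (A ∨ B) -> bfnl (D ∧ A) C -> bfnl (D ∧ B) C -> bfnl D C.
Proof.
  intros H HA HB; apply le_trans with (1 := and_r (ax_id D) H).
  exact (le_trans (ax_distr D A B) (or_le HA HB)).
Qed.

Lemma le_excluded_middle A C D : bfnl (D ∧ A) C -> bfnl (D ∧ ¬ A) C -> bfnl D C.
Proof. apply le_cases, le_trans with (2 := ax_em A), ax_top. Qed.

Lemma disjunctive_syllogism A B D :
  bfnl D (A ∨ B) -> bfnl D (¬ A) -> bfnl D B.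
Proof.
  intros H HA; apply (le_cases H); [|apply and_le_r].
  apply contradiction_le with A; [apply and_le_r|].
  exact (le_trans (and_le_l D A) HA).
Qed.

Lemma le_neg_neg A D : bfnl D A -> bfnl D (¬ ¬ A).
Proof.
  intros H; apply le_excluded_middle with (¬ A); [|apply and_le_r].
  apply contradiction_le with A; [|apply and_le_r].
  exact (le_trans (and_le_l D _) H).
Qed.

Lemma top_le_imp A B : bfnl ⊤ (¬ A ∨ B) <-> bfnl A B.
Proof.
  split; intros H.
  - apply disjunctive_syllogism with (¬ A); [|apply le_neg_neg, ax_id].
    exact (le_trans (ax_top A) H).
  - apply le_excluded_middle with A; [apply or_r2|apply or_r1; apply and_le_r].
    exact (le_trans (and_le_r _ A) H).
Qed.

Lemma prod_mono_r A B C : bfnl A B -> bfnl (C · A) (C · B).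
Proof.
  intros H; apply (@prod_l L (Hole L)).
  exact (prod_r (ax_id C) H).
Qed.

(** With [prod_mono_r] and [prod_bot], this makes [C · _] a normal diamond. *)
Lemma prod_or A B C : bfnl (C · (A ∨ B)) (C · A ∨ C · B).
Proof.
  apply (@prod_l L (Hole L)), (@or_l L (CtxR (Leaf C) (Hole L)));
    [apply or_r1|apply or_r2]; exact (prod_r (ax_id C) (ax_id _)).
Qed.

Lemma prod_bot A C : bfnl (C · ⊥) A.
Proof.
  apply (@prod_l L (Hole L)); exact (ax_bot (CtxR (Leaf C) (Hole L)) A).
Qed.

End Boolean.

(** * From K to BFNL* *)

Definition decide_bool (Q : Prop) : bool :=
  if excluded_middle_informative Q then true else false.

Lemma decide_bool_true (Q : Prop) : decide_bool Q = true <-> Q.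
Proof.
  unfold decide_bool; destruct (excluded_middle_informative Q); intuition discriminate.
Qed.

Section ToBFNL.
Variable P : Type.
Implicit Types A B C : mform P.

Section Valuation.
Variable C : bform (option P).
Hypothesis C_consistent : ~ bfnl C ⊥.

Definition val_of (p : P) : bool := decide_bool (bfnl C (BVar (Some p))).
Definition dia_of (B : mform P) : bool := decide_bool (bfnl C (BVar None · dagger B)).

(** Truth lemma for the valuation read off [C]. Deciding the left argument of a disjunction or
    implication lets disjunctive syllogism settle the right one; diamonds are atoms, evaluated by
    [dia_of]. *)
Lemma peval_val_of A :
  (forall B, In B (subformulas A) -> bfnl C (dagger B) \/ bfnl C (¬ dagger B)) ->
  peval val_of dia_of A = true <-> bfnl C (dagger A).
Proof.
  assert (Hneg : forall B, bfnl C (¬ dagger B) -> bfnl C (dagger B) -> False).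
  { intros B H H'; exact (C_consistent (contradiction_le _ H' H)). }
  induction A as [p| |A IHA B IHB|A IHA B IHB|A IHA B IHB|A IHA]; simpl; intros Hdec;
    try (specialize (IHA (fun D HD => Hdec D (or_intror (in_or_app _ _ _ (or_introl HD)))));
         specialize (IHB (fun D HD => Hdec D (or_intror (in_or_app _ _ _ (or_intror HD)))));
         assert (HA := Hdec A (or_intror (in_or_app _ _ _ (or_introl (subformulas_self A)))));
         assert (HB := Hdec B (or_intror (in_or_app _ _ _ (or_intror (subformulas_self B)))))).
  - apply decide_bool_true.
  - split; [discriminate|intros H; destruct (C_consistent H)].
  - rewrite andb_true_iff, IHA, IHB; split.
    + intros [H1 H2]; exact (and_r H1 H2).
    + intros H; split; [exact (le_trans H (and_le_l _ _))|exact (le_trans H (and_le_r _ _))].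
  - rewrite orb_true_iff, IHA, IHB; split.
    + intros [H|H]; [exact (or_r1 _ H)|exact (or_r2 _ H)].
    + intros H; destruct HA as [HA|HA]; [now left|right].
      exact (disjunctive_syllogism H HA).
  - rewrite implb_true_iff, IHA, IHB; split.
    + intros H; destruct HA as [HA|HA]; [exact (or_r2 _ (H HA))|exact (or_r1 _ HA)].
    + intros H H'; exact (disjunctive_syllogism H (le_neg_neg H')).
  - apply decide_bool_true.
Qed.

End Valuation.

(** Otherwise [¬ dagger A] is consistent, and a deciding extension of it yields a valuation
    falsifying [A]. *)
Lemma tautology_bfnl A : tautology A -> bfnl ⊤ (dagger A).
Proof.
  intros HA; apply NNPP; intros Hn.
  destruct (deciding_extension (fun X Y : bform (option P) => bfnl X Y)
              (@BAnd _) (@BNeg _) (fun D => ~ bfnl D ⊥))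
    with (s := map (@dagger P) (subformulas A)) (D := ¬ dagger A)
    as (C & Hc & HCA & Hdec).
  - apply ax_id.
  - apply le_trans.
  - apply and_le_l.
  - apply and_le_r.
  - intros D B HD; apply NNPP; intros H; apply HD.
    apply le_excluded_middle with B; apply NNPP; tauto.
  - intros H; apply Hn, le_excluded_middle with (dagger A); [apply and_le_r|].
    apply le_trans with (1 := and_le_r _ _), le_trans with (1 := H), bot_le.
  - apply Hc, contradiction_le with (dagger A); [|exact HCA].
    apply (peval_val_of Hc); [|apply HA].
    intros B HB; apply Hdec, in_map, HB.
Qed.

Lemma bfnl_mp A B : bfnl ⊤ (dagger (A ⊃ B)) -> bfnl ⊤ (dagger A) -> bfnl ⊤ (dagger B).
Proof. simpl; rewrite top_le_imp; intros H HA; exact (le_trans HA H). Qed.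

Lemma bfnl_dia_mono A B :
  bfnl ⊤ (dagger (A ⊃ B)) -> bfnl ⊤ (dagger (◇ A ⊃ ◇ B)).
Proof. simpl; rewrite !top_le_imp; apply prod_mono_r. Qed.

Lemma K_theorem_top_bfnl A : K_theorem A -> bfnl ⊤ (dagger A).
Proof.
  induction 1 as [A HA|A B|A|A|A B _ IHAB _ IHA|A _ IHA].
  - exact (tautology_bfnl HA).
  (* Contraposed, distribution is additivity of the diamond, supplied by [prod_or]. *)
  - assert (H : bfnl ⊤ (dagger (◇ ¬ B ⊃ ◇ ¬ (A ⊃ B) ∨ ◇ ¬ A)%modal)).
    { apply top_le_imp, le_trans with (2 := prod_or _ _ _), prod_mono_r.
      apply top_le_imp, (@tautology_bfnl (¬ B ⊃ ¬ (A ⊃ B) ∨ ¬ A)%modal); taut. }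
    apply bfnl_mp with (2 := H), tautology_bfnl; taut.
  - assert (H : bfnl ⊤ (dagger (◇ A ⊃ ◇ ¬ ¬ A)%modal)).
    { apply bfnl_dia_mono, tautology_bfnl; taut. }
    apply bfnl_mp with (2 := H), tautology_bfnl; taut.
  - assert (H : bfnl ⊤ (dagger (◇ ¬ ¬ A ⊃ ◇ A)%modal)).
    { apply bfnl_dia_mono, tautology_bfnl; taut. }
    apply bfnl_mp with (2 := H), tautology_bfnl; taut.
  - exact (bfnl_mp IHAB IHA).
  (* Since [A] is provable, the translation of its negation lies below [⊥], and the product with [⊥]
     collapses. *)
  - apply top_le_imp, le_trans with (BVar None · ⊥); [apply prod_mono_r|apply prod_bot].
    apply top_le_imp, (@bfnl_mp A (¬ ¬ A)%modal); [|exact IHA].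
    apply tautology_bfnl; taut.
Qed.

End ToBFNL.

(** * Unital ternary frames *)

Section Frame.
Variables (L W : Type) (S : W -> W -> W -> Prop) (e : W) (val : L -> W -> Prop).
Hypothesis unit_l : forall x z, S x e z <-> x = z.
Hypothesis unit_r : forall x z, S x z e <-> x = z.

(** [S x y z] reads: [x] splits into [y] and [z], in this order. The residuals quantify over the
    wholes [z] of which [x] is a part. *)
Fixpoint sat (A : bform L) (x : W) : Prop :=
  match A with
  | BVar p => val p x
  | BTop => True
  | BBot => False
  | BNeg B => ~ sat B x
  | BAnd B C => sat B x /\ sat C x
  | BOr B C => sat B x \/ sat C x
  | BProd B C => exists y z, S x y z /\ sat B y /\ sat C z
  | BUnder B C => forall z y, S z y x -> sat B y -> sat C z
  | BOver C B => forall z y, S z x y -> sat B y -> sat C z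
  end.

Fixpoint tree_sat (T : tree L) (x : W) : Prop :=
  match T with
  | Leaf A => sat A x
  | Node T U => exists y z, S x y z /\ tree_sat T y /\ tree_sat U z
  end.

Definition ant_sat (X : antecedent L) (x : W) : Prop :=
  match X with
  | None => x = e
  | Some T => tree_sat T x
  end.

(** The context as a binary relation: [x] at the root can be split along [G] so that [y] falls to
    the hole. Rules acting inside a context then need checking only at the hole. *)
Fixpoint ctx_rel (G : ctx L) (x y : W) : Prop :=
  match G with
  | Hole _ => x = y
  | CtxL G' T => exists u t, S x u t /\ ctx_rel G' u y /\ tree_sat T t
  | CtxR T G' => exists t u, S x t u /\ tree_sat T t /\ ctx_rel G' u y
  end.

(** When a side is empty, its point is [e] and a unit law collapses the split. *)
Lemma ant_sat_comp (X Y : antecedent L) (x : W) :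
  ant_sat (X ∘ Y) x <-> exists y z, S x y z /\ ant_sat X y /\ ant_sat Y z.
Proof.
  destruct X as [T|], Y as [U|]; simpl; try tauto; split.
  - intros H; exists x, e; rewrite unit_r; auto.
  - intros (y & z & HS & H & ->); apply unit_r in HS; now subst.
  - intros H; exists e, x; rewrite unit_l; auto.
  - intros (y & z & HS & -> & H); apply unit_l in HS; now subst.
  - intros ->; exists e, e; rewrite unit_l; auto.
  - intros (y & z & HS & -> & ->); now apply unit_l.
Qed.

Lemma ant_sat_plug (G : ctx L) (X : antecedent L) (x : W) :
  ant_sat (plug G X) x <-> exists y, ctx_rel G x y /\ ant_sat X y.
Proof.
  revert x; induction G as [|G IH T|T G IH]; intros x; cbn [plug ctx_rel].
  - split; [intros H; exists x; auto|intros (y & -> & H); exact H].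
  - rewrite ant_sat_comp; cbn [ant_sat]; split.
    + intros (u & t & HS & Hu & Ht); apply IH in Hu as (y & Hy & HX).
      exists y; split; [exists u, t|]; auto.
    + intros (y & (u & t & HS & Hu & Ht) & HX); exists u, t; rewrite IH; eauto 6.
  - rewrite ant_sat_comp; cbn [ant_sat]; split.
    + intros (t & u & HS & Ht & Hu); apply IH in Hu as (y & Hy & HX).
      exists y; split; [exists t, u|]; auto.
    + intros (y & (t & u & HS & Ht & Hu) & HX); exists t, u; rewrite IH; eauto 6.
Qed.

Lemma plug_valid (G : ctx L) (X : antecedent L) (A : bform L) :
  (forall x, ant_sat (plug G X) x -> sat A x) <->
  (forall x y, ctx_rel G x y -> ant_sat X y -> sat A x).
Proof.
  split.
  - intros H x y HG HX; apply H, ant_sat_plug; eauto.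
  - intros H x Hx; apply ant_sat_plug in Hx as (y & HG & HX); eauto.
Qed.

Lemma bfnl_sound (X : antecedent L) (A : bform L) :
  bfnl X A -> forall x, ant_sat X x -> sat A x.
Proof.
  induction 1; rewrite ?plug_valid in *; try (simpl in *; solve [intuition eauto]).
  (* What remains is excluded middle, the four residual rules and [prod_r]. *)
  - intros x _; simpl; apply classic.
  - intros x y HG HX; apply ant_sat_comp in HX as (u & t & HS & HX & HA).
    exact (IHbfnl2 _ _ HG (HA _ _ HS (IHbfnl1 _ HX))).
  - intros y Hy x a HS Ha; apply IHbfnl, ant_sat_comp; exists a, y; auto.
  - intros x y HG HX; apply ant_sat_comp in HX as (u & t & HS & HA & HX).
    exact (IHbfnl1 _ _ HG (HA _ _ HS (IHbfnl2 _ HX))).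
  - intros y Hy x b HS Hb; apply IHbfnl, ant_sat_comp; exists y, b; auto.
  - intros x HX; apply ant_sat_comp in HX as (y & z & HS & HX & HY).
    exists y, z; auto.
Qed.

End Frame.

(** * Kripke models as unital frames *)

Section Kripke.
Variables (P W : Type) (R : W -> W -> Prop) (V : P -> W -> Prop).

Fixpoint force (A : mform P) (u : W) : Prop :=
  match A with
  | MVar p => V p u
  | MBot => False
  | MAnd B C => force B u /\ force C u
  | MOr B C => force B u \/ force C u
  | MImp B C => force B u -> force C u
  | MDia B => exists v, R u v /\ force B v
  end.

Variable w : W.

Inductive point : Type :=
| Root : point
| Mu : point
| World : W -> point.

(* The value at [Mu] is junk. *)
Definition world_of (x : point) : W :=
  match x with World u => u | _ => w end.

(** A step has [Mu] as second and a [World] as third argument, never [Root], so it cannot break the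
    unit laws of [Root]. *)
Inductive point_rel : point -> point -> point -> Prop :=
| rel_unit_l : forall x, point_rel x Root x
| rel_unit_r : forall x, point_rel x x Root
| rel_step : forall x v,
    x <> Mu -> R (world_of x) v -> point_rel x Mu (World v).

Definition point_val (l : option P) (x : point) : Prop :=
  match l with
  | Some p => V p (world_of x)
  | None => x = Mu
  end.

Lemma point_unit_l (x z : point) : point_rel x Root z <-> x = z.
Proof. split; [inversion 1; auto|intros ->; constructor]. Qed.

Lemma point_unit_r (x z : point) : point_rel x z Root <-> x = z.
Proof. split; [inversion 1; auto|intros ->; constructor]. Qed.

Lemma sat_dagger (A : mform P) (x : point) :
  x <> Mu -> sat point_rel point_val (dagger A) x <-> force A (world_of x).
Proof.
  revert x; induction A as [p| |A IHA B IHB|A IHA B IHB|A IHA B IHB|A IHA];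
    intros x Hx; simpl; try rewrite IHA, IHB by exact Hx; try tauto.
  split.
  (* A split with first part [Mu] is a step along [R] or the unit split of [Mu] itself, which [Hx]
     excludes. *)
  - intros (y & z & HS & -> & HA); inversion HS; subst; try congruence.
    exists v; split; [assumption|]. now apply IHA in HA.
  - intros (v & HR & HA); exists Mu, (World v); split; [now constructor|].
    split; [reflexivity|]. now apply IHA.
Qed.

Lemma bfnl_dagger_force (A : mform P) : bfnl empty (dagger A) -> force A w.
Proof.
  intros H; apply (@sat_dagger A Root); [discriminate|].
  now apply (bfnl_sound point_rel Root point_val point_unit_l point_unit_r H).
Qed.

End Kripke.

(** * Kripke completeness of K *)

Section Completeness.
Local Open Scope modal_scope.
Variable P : Type.
Implicit Types A B C D : mform P.

Lemma K_conseq A B : tautology (A ⊃ B) -> K_theorem A -> K_theorem B.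
Proof. intros H; apply K_mp, K_taut, H. Qed.

Lemma K_conseq2 A B C :
  tautology (A ⊃ B ⊃ C) -> K_theorem A -> K_theorem B -> K_theorem C.
Proof. intros H HA; apply K_mp, K_conseq with (1 := H), HA. Qed.

Lemma K_trans A B C : K_theorem (A ⊃ B) -> K_theorem (B ⊃ C) -> K_theorem (A ⊃ C).
Proof. apply K_conseq2; taut. Qed.

Lemma K_dia_false A : K_theorem (¬ A) -> K_theorem (¬ ◇ A).
Proof.
  intros H; apply K_nec in H.
  apply K_conseq2 with (2 := K_dual1 A) (3 := H); taut.
Qed.

(** Distributing the box twice gives [□ ¬ A ⊃ □ ¬ B ⊃ □ ¬ (A ∨ B)]; contraposition and duality do
    the rest. *)
Lemma K_dia_or A B : K_theorem (◇ (A ∨ B) ⊃ ◇ A ∨ ◇ B).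
Proof.
  assert (H : K_theorem (□ (¬ A ⊃ ¬ B ⊃ ¬ (A ∨ B)))).
  { apply K_nec, K_taut; taut. }
  apply (K_mp (K_dist _ _)) in H.
  assert (H' := K_trans H (K_dist _ _)).
  assert (H1 : K_theorem (◇ (A ∨ B) ⊃ ¬ □ ¬ A ∨ ¬ □ ¬ B)).
  { apply K_conseq2 with (2 := H') (3 := K_dual1 (A ∨ B)); taut. }
  assert (H2 : K_theorem (◇ (A ∨ B) ⊃ ◇ A ∨ ¬ □ ¬ B)).
  { apply K_conseq2 with (2 := H1) (3 := K_dual2 A); taut. }
  apply K_conseq2 with (2 := H2) (3 := K_dual2 B); taut.
Qed.

Lemma K_dia_mono A B : K_theorem (A ⊃ B) -> K_theorem (◇ A ⊃ ◇ B).
Proof.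
  intros H.
  assert (H1 : K_theorem (□ (¬ B ⊃ ¬ A))).
  { apply K_nec, K_conseq with (2 := H); taut. }
  apply (K_mp (K_dist _ _)) in H1.
  apply K_trans with (2 := K_dual2 B).
  apply K_conseq2 with (2 := H1) (3 := K_dual1 A); taut.
Qed.

Variable A0 : mform P.

Definition canonical_world C : Prop :=
  ~ K_theorem (¬ C) /\
  forall B, In B (subformulas A0) -> K_theorem (C ⊃ B) \/ K_theorem (C ⊃ ¬ B).

(** Consistency of [C] with [◇ D] replaces the usual canonical relation, as [C] need not decide
    [◇ D]. All formulas are points of the model, so the relation itself keeps successors among the
    worlds. *)
Definition canonical_rel C D : Prop :=
  canonical_world D /\ ~ K_theorem (¬ (C ∧ ◇ D)).

Definition canonical_val (p : P) C : Prop := K_theorem (C ⊃ MVar p).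

(** [cons] may be stronger than consistency: [canonical_world_dia] also preserves compatibility with
    a predecessor. *)
Lemma canonical_world_extension (cons : mform P -> Prop) D :
  (forall D, cons D -> ~ K_theorem (¬ D)) ->
  (forall D B, cons D -> cons (D ∧ B) \/ cons (D ∧ ¬ B)) ->
  cons D ->
  exists D', cons D' /\ canonical_world D' /\ K_theorem (D' ⊃ D).
Proof.
  intros Hcons Hsplit HD.
  destruct (deciding_extension (fun X Y => K_theorem (X ⊃ Y)) (@MAnd P) (@MNeg P) cons)
    with (s := subformulas A0) (D := D) as (D' & Hc & Hle & Hdec); auto.
  - intros; apply K_taut; taut.
  - apply K_trans.
  - intros; apply K_taut; taut.
  - intros; apply K_taut; taut.
  - exists D'; unfold canonical_world; auto.
Qed.

(** [B] is extended while staying compatible with [C]. One of the two choices always works, because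
    [◇ D] implies [◇ (D ∧ B') ∨ ◇ (D ∧ ¬ B')]. *)
Lemma canonical_world_dia B C :
  canonical_world C -> K_theorem (C ⊃ ◇ B) ->
  exists D, canonical_rel C D /\ K_theorem (D ⊃ B).
Proof.
  intros HC HB.
  destruct (canonical_world_extension (fun D => ~ K_theorem (¬ (C ∧ ◇ D))) B)
    as (D & Hc & HD & Hle).
  - intros D HD H; apply HD; apply K_conseq with (2 := K_dia_false H); taut.
  - intros D B' HD; apply NNPP; intros H; apply HD.
    assert (H1 : K_theorem (¬ (C ∧ ◇ (D ∧ B')))) by (apply NNPP; tauto).
    assert (H2 : K_theorem (¬ (C ∧ ◇ (D ∧ ¬ B')))) by (apply NNPP; tauto).
    assert (H3 : K_theorem (◇ D ⊃ ◇ (D ∧ B') ∨ ◇ (D ∧ ¬ B'))).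
    { apply K_trans with (2 := K_dia_or _ _), K_dia_mono, K_taut; taut. }
    assert (H4 : K_theorem (¬ (C ∧ (◇ (D ∧ B') ∨ ◇ (D ∧ ¬ B'))))).
    { apply K_conseq2 with (2 := H1) (3 := H2); taut. }
    apply K_conseq2 with (2 := H3) (3 := H4); taut.
  - intros H; apply (proj1 HC), K_conseq2 with (2 := HB) (3 := H); taut.
  - exists D; unfold canonical_rel; auto.
Qed.

Lemma canonical_truth B C :
  incl (subformulas B) (subformulas A0) -> canonical_world C ->
  force canonical_rel canonical_val B C <-> K_theorem (C ⊃ B).
Proof.
  revert C; induction B as [p| |A IHA B IHB|A IHA B IHB|A IHA B IHB|A IHA];
    simpl; intros C Hincl HC; apply incl_cons_inv in Hincl as [Hself Hincl];
    try (apply incl_app_inv in Hincl as [HinclA HinclB];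
         specialize (IHA C HinclA HC); specialize (IHB C HinclB HC);
         assert (HA := proj2 HC A (HinclA _ (subformulas_self A)));
         assert (HB := proj2 HC B (HinclB _ (subformulas_self B))));
    try rewrite IHA, IHB.
  - reflexivity.
  - split; [tauto|]. intros H; exact (proj1 HC H).
  - split.
    + intros [H1 H2]; apply K_conseq2 with (2 := H1) (3 := H2); taut.
    + intros H; split; apply K_conseq with (2 := H); taut.
  - split.
    + intros [H|H]; apply K_conseq with (2 := H); taut.
    + intros H; destruct HA as [HA|HA]; [now left|right].
      apply K_conseq2 with (2 := H) (3 := HA); taut.
  - split.
    + intros H; destruct HA as [HA|HA].
      * apply K_conseq with (2 := H HA); taut.
      * apply K_conseq with (2 := HA); taut.
    + intros H HA'; apply K_conseq2 with (2 := H) (3 := HA'); taut.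
  - split.
    + intros (D & [HD HCD] & HA); apply (IHA D Hincl HD) in HA.
      (* If [C] refuted [◇ A], it would refute [◇ D] by monotonicity, against [canonical_rel]. *)
      destruct (proj2 HC _ Hself) as [H|H]; [exact H|destruct HCD].
      apply K_dia_mono in HA; apply K_conseq2 with (2 := HA) (3 := H); taut.
    + intros H; destruct (canonical_world_dia HC H) as (D & HR & HD).
      exists D; split; [exact HR|]. now apply (IHA D Hincl (proj1 HR)).
Qed.

End Completeness.

(** If [A] is unprovable, [¬ A] extends to a canonical world, where the truth lemma contradicts
    validity of [A]. *)
Lemma K_complete (P : Type) (A : mform P) :
  (forall (W : Type) (R : W -> W -> Prop) (V : P -> W -> Prop) (w : W), force R V A w) ->
  K_theorem A.
Proof.
  intros HA; apply NNPP; intros Hn.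
  destruct (canonical_world_extension A (fun D => ~ K_theorem (¬ D)%modal) (¬ A)%modal)
    as (C & _ & HC & HCA).
  - auto.
  - intros D B HD; apply NNPP; intros H; apply HD.
    apply K_conseq2 with (¬ (D ∧ B))%modal (¬ (D ∧ ¬ B))%modal;
      [taut|apply NNPP; tauto|apply NNPP; tauto].
  - intros H; apply Hn, K_conseq with (2 := H); taut.
  - assert (H := proj1 (canonical_truth A (incl_refl _) HC) (HA _ _ _ C)).
    apply (proj1 HC), K_conseq2 with (2 := HCA) (3 := H); taut.
Qed.

Theorem theorem3 (P : Type) (A : mform P) :
  K_theorem A <-> bfnl empty (dagger A).
Proof.
  split.
  (* Cutting with [⇒ ⊤] replaces the antecedent [⊤] by the empty one. *)
  - intros H; exact (cut (Hole _) (ax_top empty) (K_theorem_top_bfnl H)).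
  - intros H; apply K_complete; intros W R V w; now apply bfnl_dagger_force.
Qed.
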